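(* Let $Y$ be a topological vector space, let $A$ be a closed proper subset of $Y$, and let $k\in-\operatorname{int}0^+A$. Then $k\neq0$, $A-\mathbb{R}_{>}k\subseteq\operatorname{int}A$, and $\varphi_{A,k}$ is continuous and finite-valued. Moreover, $0^+A$ is a closed proper subset of $Y$, $k\in-\operatorname{int}0^+(0^+A)$, and $$\varphi_{A,k}(y^0)-\varphi_{A,k}(y^1)\le\varphi_{0^+A,k}(y^0-y^1)\quad\forall y^0,y^1\in Y.$$
   Context: Vector spaces are real; $\mathbb{R}_{>}=\{t\in\mathbb{R}\mid t>0\}$. ''Proper subset of $Y$'' means nonempty and different from $Y$. $0^+A=\{u\in Y\mid a+tu\in A\ \forall a\in A,\ \forall t\ge0\}$ is the recession cone. $\nu$ is a symbolic value not in $\overline{\mathbb{R}}=\mathbb{R}\cup\{\pm\infty\}$, and $\inf\emptyset:=\nu$. For $M\subseteq Y$, $\varphi_{M,k}:Y\to\overline{\mathbb{R}}\cup\{\nu\}$ is $\varphi_{M,k}(y)=\inf\{t\in\mathbb{R}\mid y\in tk+M\}$; it is finite-valued if $\varphi_{M,k}(y)\in\mathbb{R}$ for all $y\in Y$. *)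

(* Defs.v *)
From HB Require Import structures.
From mathcomp Require Import all_boot all_order all_algebra.
From mathcomp Require Import boolp classical_sets reals ereal topology tvs.
From mathcomp Require Import normedtype.

Set Implicit Arguments.
Unset Strict Implicit.
Unset Printing Implicit Defensive.

Import Order.TTheory GRing.Theory Num.Theory.
Import numFieldNormedType.Exports.

Local Open Scope classical_set_scope.
Local Open Scope ring_scope.

Definition proper_subset {T : Type} (A : set T) : Prop := A !=set0 /\ A <> setT.

Definition recession_cone {R : realType} {Y : lmodType R} (A : set Y) : set Y :=
  [set u | forall a, A a -> forall t : R, 0 <= t -> A (a + t *: u)].

(* [None] is the symbolic value nu. *)
Definition nuereal (R : realType) : Type := option (\bar R).

Definition nu_inf {R : realType} (S : set R) : nuereal R :=
  if `[< S = set0 >] then None else Some (ereal_inf [set t%:E | t in S]).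

(* Differences involving nu, and the differences (+oo) - (+oo) and
   (-oo) - (-oo), have the value nu. *)
Definition nu_sub {R : realType} (x y : nuereal R) : nuereal R :=
  match x, y with
  | Some a, Some b => if (a +? - b)%E then Some (a - b)%E else None
  | _, _ => None
  end.

(* nu is not comparable with any value, itself included. *)
Definition nu_le {R : realType} (x y : nuereal R) : Prop :=
  match x, y with
  | Some a, Some b => (a <= b)%E
  | _, _ => False
  end.

Definition nu_finite_valued {R : realType} {T : Type} (f : T -> nuereal R) : Prop :=
  forall x, exists r : R, f x = Some r%:E.

(* Continuity into the extended reals with their usual topology; such a
   function never takes the value nu. *)
Definition nu_continuous {R : realType} {T : topologicalType}
    (f : T -> nuereal R) : Prop :=
  exists g : T -> \bar R, (forall x, f x = Some (g x)) /\ continuous g.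

Definition phi {R : realType} {Y : lmodType R} (M : set Y) (k : Y) (y : Y) :
    nuereal R :=
  nu_inf [set t : R | [set t *: k + m | m in M] y].

(* Main.v *)
Require Import Defs.
From HB Require Import structures.
From mathcomp Require Import all_boot all_order all_algebra.
From mathcomp Require Import boolp classical_sets reals ereal topology tvs.
From mathcomp Require Import normedtype.

Set Implicit Arguments.
Unset Strict Implicit.
Unset Printing Implicit Defensive.

Import Order.TTheory GRing.Theory Num.Theory.
Import numFieldNormedType.Exports.

Local Open Scope classical_set_scope.
Local Open Scope ring_scope.

(** Write C for the recession cone of A. It is a convex cone with
    A + C included in A, and [- k] is interior to C.

    An interior point [u] of a convex cone absorbs the space: for every [y],
    [u + r *: y] stays in C for small [r > 0], so by scaling
    [y + r^-1 *: u] is in C ([recession_cone_absorbing]). If [u] were 0, this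
    would give C = Y, hence A = Y; thus [k] is nonzero. The neighbourhood
    [a + t *: C] of [a - t *: k] is included in A, which gives the inclusion in
    the interior.

    The value of phi at [y] is the infimum of the set of [t] such that
    [y - t *: k] is in A. Absorption makes this set nonempty, because a point
    of A can be moved to any [y] along C, and bounded below, because a point
    outside A could otherwise be reached from A along C.

    Continuity and the inequality follow from one estimate, [inf_levels_le]: if
    [z - s *: k] is in C, then phi A k (y + z) <= phi A k y + s, since adding
    an element of C does not leave A. The infimum over [s] is the subadditivity
    inequality with phi of C. For continuity, fix [s] to be [e > 0]: the
    vectors [z] for which both [z - e *: k] and [- z - e *: k] are in C form a
    neighbourhood of 0, because [- (e *: k)] is interior to C.

    Finally C is closed as an intersection of preimages of A under continuous
    affine maps, and, being a convex cone, it is included in its own recession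
    cone, so that [- k] is interior to the latter and the previous results
    apply to C as well. *)

Section RecessionCone.
Variables (R : realType) (Y : lmodType R).
Implicit Types (A : set Y) (a u v : Y).

Lemma recession_cone0 A : recession_cone A 0.
Proof. by move=> a Aa t _; rewrite scaler0 addr0. Qed.

Lemma recession_coneD A u v :
  recession_cone A u -> recession_cone A v -> recession_cone A (u + v).
Proof.
move=> Cu Cv a Aa t t0; rewrite scalerDr addrA.
by apply: (Cv _ _ _ t0); exact: Cu.
Qed.

Lemma recession_coneZ A u (s : R) :
  0 <= s -> recession_cone A u -> recession_cone A (s *: u).
Proof.
by move=> s0 Cu a Aa t t0; rewrite scalerA; apply: Cu => //; exact: mulr_ge0.
Qed.

Lemma recession_cone_add A a u : A a -> recession_cone A u -> A (a + u).
Proof. by move=> Aa Cu; rewrite -[u]scale1r; exact: Cu. Qed.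

(** A vector joining a point of A to a point outside A is not a recession
    direction. *)
Lemma recession_coneT A : A !=set0 -> recession_cone A = setT -> A = setT.
Proof.
move=> [a Aa] CT; apply/seteqP; split=> // y _; rewrite -(subrK a y) addrC.
by apply: recession_cone_add => //; rewrite CT.
Qed.

Lemma proper_recession_cone A :
  proper_subset A -> proper_subset (recession_cone A).
Proof.
move=> [A0 AT]; split; first by exists 0; exact: recession_cone0.
by move/(recession_coneT A0).
Qed.

(** A convex cone is stable under adding nonnegative multiples of its own
    elements. *)
Lemma sub_recession_cone2 A :
  recession_cone A `<=` recession_cone (recession_cone A).
Proof.
by move=> u Cu v Cv t t0; apply: recession_coneD => //; exact: recession_coneZ.
Qed.

End RecessionCone.

Section TopologicalRecessionCone.
Variables (R : realType) (Y : topologicalLmodType R).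
Implicit Types (A : set Y) (a u y z : Y).

(** Joint continuity of addition and scaling, in the only form in which the
    vector topology is used below: [c] varies when a point is moved along a
    line, [g] varies when it is moved by an affine map. *)
Lemma cvg_affine {T : Type} (F : set_system T) (FF : Filter F)
    (c : T -> R^o) (f g : T -> Y) (l : R) a y :
  f @ F --> a -> c @ F --> (l : R^o) -> g @ F --> y ->
  (fun x => f x + c x *: g x) @ F --> a + l *: y.
Proof.
move=> fa cl gy.
apply: (@continuous2_cvg T Y Y Y F FF f (fun x => c x *: g x)
  (fun u v => u + v)) => //.
  exact: (@add_continuous Y (a, l *: y)).
apply: (@continuous2_cvg T R^o Y Y F FF c g
  (fun (r : R^o) (u : Y) => r *: u)) => //.
exact: (@scale_continuous R Y (l, y)).
Qed.

Lemma affine_continuous a (t : R) : continuous (fun u => a + t *: u).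
Proof.
by move=> u; apply: cvg_affine; [exact: cvg_cst|exact: cvg_cst|exact: cvg_id].
Qed.

Lemma closed_recession_cone A : closed A -> closed (recession_cone A).
Proof.
move=> cA.
have -> : recession_cone A =
    \bigcap_(at_ in [set p : Y * R | A p.1 /\ 0 <= p.2])
      ((fun u => at_.1 + at_.2 *: u) @^-1` A).
  apply/seteqP; split=> [u Cu [a t] [Aa t0]|u Cu a Aa t t0]; first exact: Cu.
  exact: (Cu (a, t)).
apply: closed_bigI => -[a t] _; apply: preimage_closed => // u _.
exact: affine_continuous.
Qed.

(** Scaling by [s > 0] is a homeomorphism that preserves the cone. *)
Lemma interior_recession_coneZ A u (s : R) :
  0 < s -> interior (recession_cone A) u ->
  interior (recession_cone A) (s *: u).
Proof.
move=> s0 Cu.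
have c : (fun v : Y => 0 + s^-1 *: v) @ (s *: u) --> u.
  have := @affine_continuous 0 s^-1 (s *: u).
  by rewrite /continuous_at add0r scalerK ?gt_eqF.
apply: filterS (c _ Cu : nbhs (s *: u) _) => v /= Cv.
rewrite -[v](scalerKV (lt0r_neq0 s0)) -[_^-1 *: _]add0r.
by apply: recession_coneZ Cv; exact: ltW.
Qed.

(** For small [r > 0] the vector [u + r *: y] is still in the cone; divide by
    [r]. *)
Lemma recession_cone_absorbing A u y :
  interior (recession_cone A) u -> exists s : R, recession_cone A (y + s *: u).
Proof.
move=> Cu.
have c : (fun r : R => u + (r : R^o) *: y) @ (0 : R) --> u.
  rewrite -[X in _ --> X]addr0 -[X in u + X](scale0r y).
  by apply: cvg_affine; [exact: cvg_cst|exact: cvg_id|exact: cvg_cst].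
have [e /= e0 He] := c _ Cu.
(* [e] is the radius of an open ball of admissible [r]; [e / 2] is one such
   [r] that is positive. *)
have e2 : 0 < e / 2 by rewrite divr_gt0.
exists (e / 2)^-1; rewrite -[y](scalerK (lt0r_neq0 e2)) -scalerDr addrC.
apply: recession_coneZ; first by rewrite invr_ge0 ltW.
apply: He => /=; rewrite sub0r normrN gtr0_norm //.
by rewrite ltr_pdivrMr // ltr_pMr // ltr1n.
Qed.

(** If 0 absorbs the space into the cone, the cone is the whole space. *)
Lemma interior_recession_cone_neq0 A u :
  proper_subset A -> interior (recession_cone A) u -> u <> 0.
Proof.
move=> /proper_recession_cone[_ CT] Cu u0; apply: CT.
apply/seteqP; split=> // y _.
by have [s] := recession_cone_absorbing y Cu; rewrite u0 scaler0 addr0.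
Qed.

(** The translate of the cone by [a] is a neighbourhood of [a + u] contained
    in A. *)
Lemma recession_cone_add_interior A a u :
  A a -> interior (recession_cone A) u -> interior A (a + u).
Proof.
move=> Aa Cu.
have c : (fun v : Y => - a + 1 *: v) @ (a + u) --> u.
  have := @affine_continuous (- a) 1 (a + u).
  by rewrite /continuous_at scale1r addKr.
apply: filterS (c _ Cu : nbhs (a + u) _) => v /=; rewrite scale1r => Cv.
by rewrite -(addrNK a v) addrC [v - a]addrC; exact: recession_cone_add.
Qed.

End TopologicalRecessionCone.

Section Phi.
Variables (R : realType) (Y : topologicalLmodType R).
Implicit Types (A : set Y) (k y z : Y) (s t : R).

Definition levels A k y : set R := [set t | A (y - t *: k)].

Lemma phiE A k y : phi A k y = nu_inf (levels A k y).
Proof.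
congr nu_inf; apply/seteqP; split=> t /=.
  by move=> [m Am <-]; rewrite /levels /= addrC addKr.
by exists (y - t *: k) => //; rewrite addrC subrK.
Qed.

Lemma levels_shift A k y z s t :
  recession_cone A (z - s *: k) -> levels A k y t -> levels A k (y + z) (t + s).
Proof.
by move=> Cz At; rewrite /levels /= scalerDl opprD addrACA; exact: recession_cone_add.
Qed.

Variables (A : set Y) (k : Y).
Hypotheses (A_proper : proper_subset A) (kC : interior (recession_cone A) (- k)).

Lemma recession_cone_levels z : exists s : R, recession_cone A (z - s *: k).
Proof. by have [s] := recession_cone_absorbing z kC; rewrite scalerN; exists s. Qed.

(** Start from the level 0 of a point [a] of A, and move along [y - a]. *)
Lemma levels_neq0 y : levels A k y !=set0.
Proof.
have [[a Aa] _] := A_proper; have [s Cs] := recession_cone_levels (y - a).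
exists (0 + s); rewrite -(subrK a y) addrC.
by apply: levels_shift => //; rewrite /levels /= scale0r subr0.
Qed.

(** Let [b] be outside A and [b - y - s *: k] in the cone. A level [t < - s]
    of [y] would yield the level [t + s < 0] of [b], and raising it to 0 along
    the recession direction [- k] would put [b] in A. *)
Lemma has_lbound_levels y : has_lbound (levels A k y).
Proof.
have [_ /eqP /setTPn[b nAb]] := A_proper.
have [s Cs] := recession_cone_levels (b - y).
exists (- s) => t At; rewrite leNgt; apply/negP => ts; apply: nAb.
have := levels_shift Cs At; rewrite addrC subrK /levels /= => Ab.
rewrite -[b](subrK ((t + s) *: k)); apply: recession_cone_add => //.
rewrite -[_ *: k]opprK -scalerN -scaleNr.
apply: recession_coneZ; last exact: interior_subset.
by rewrite oppr_ge0 -lerBrDr sub0r ltW.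
Qed.

Lemma phi_inf y : phi A k y = Some (inf (levels A k y))%:E.
Proof.
rewrite phiE /nu_inf; case: asboolP => [E|_].
  by have [t] := levels_neq0 y; rewrite E.
by rewrite ereal_inf_EFin//; [exact: has_lbound_levels|exact: levels_neq0].
Qed.

(** The estimate behind both continuity and subadditivity: if [z - s *: k] is a
    recession direction, every level of [y], increased by [s], is a level of
    [y + z]. *)
Lemma inf_levels_le y z s : recession_cone A (z - s *: k) ->
  inf (levels A k (y + z)) <= inf (levels A k y) + s.
Proof.
move=> Cz; rewrite -lerBlDr; apply: lb_le_inf; first exact: levels_neq0.
move=> t At; rewrite lerBlDr; apply: ge_inf; first exact: has_lbound_levels.
exact: levels_shift.
Qed.

(** Apply [inf_levels_le] with the constant [e] to the increments [z - y] and
    [y - z]; both conditions hold for [z] near [y] since [- (e *: k)] is an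
    interior point of the cone. *)
Lemma inf_levels_continuous : continuous (fun y => inf (levels A k y)).
Proof.
move=> y; apply/cvgrPdist_le => e e0.
have Ce : interior (recession_cone A) (- (e *: k)).
  by rewrite -scalerN; exact: interior_recession_coneZ.
have c (s : R) : (fun z : Y => - (e *: k) - s *: y + s *: z) @ y --> - (e *: k).
  have := @affine_continuous R Y (- (e *: k) - s *: y) s y.
  by rewrite /continuous_at subrK.
apply: filterS2 (c 1 _ Ce : nbhs y _) (c (- 1) _ Ce : nbhs y _) => z /=.
rewrite !scaleN1r !scale1r opprK => Czy Cyz.
rewrite ler_distlC; apply/andP; split.
  rewrite lerBlDr -[in leLHS](subrK z y) [y - z + z]addrC.
  by apply: inf_levels_le; rewrite addrC addrA.
rewrite -[in leLHS](subrK y z) [z - y + y]addrC.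
by apply: inf_levels_le; rewrite [z - y]addrC [_ - e *: k]addrC addrA.
Qed.

End Phi.

Theorem proposition12 (R : realType) (Y : topologicalLmodType R)
    (A : set Y) (k : Y)
    (A_closed : closed A) (A_proper : proper_subset A)
    (hk : [set - u | u in interior (recession_cone A)] k) :
  (k <> 0 /\
   [set a - t *: k | a in A & t in [set t : R | 0 < t]] `<=` interior A /\
   nu_continuous (phi A k) /\ nu_finite_valued (phi A k)) /\
  (closed (recession_cone A) /\ proper_subset (recession_cone A) /\
   [set - u | u in interior (recession_cone (recession_cone A))] k /\
   forall y0 y1 : Y,
     nu_le (nu_sub (phi A k y0) (phi A k y1))
           (phi (recession_cone A) k (y0 - y1))).
Proof.
have kC : interior (recession_cone A) (- k) by case: hk => u Cu <-; rewrite opprK.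
have kCC : interior (recession_cone (recession_cone A)) (- k).
  by apply: filterS kC; exact: sub_recession_cone2.
have C_proper := proper_recession_cone A_proper.
split; [split; [|split; [|split]]|split; [|split; [|split]]] => //.
- by move=> k0; apply: (interior_recession_cone_neq0 A_proper kC); rewrite k0 oppr0.
- move=> _ [a Aa [t /= t0 <-]]; rewrite -scalerN.
  by apply: recession_cone_add_interior => //; exact: interior_recession_coneZ.
- exists (fun y => (inf (levels A k y))%:E); split=> [y|y]; first exact: phi_inf.
  apply: cvg_EFin; first exact: nearW.
  exact: inf_levels_continuous.
- by move=> y; exists (inf (levels A k y)); exact: phi_inf.
- exact: closed_recession_cone.
- by exists (- k); rewrite ?opprK.
- move=> y0 y1; rewrite !phi_inf //= -EFinB lee_fin.
  apply: lb_le_inf; first exact: levels_neq0.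
  move=> s Cs; rewrite lerBlDl -[in leLHS](subrK y1 y0) [y0 - y1 + y1]addrC.
  exact: inf_levels_le.
Qed.
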